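(* Let $k$ be a positive integer, $c=c(x)$ a smooth function, $D=\frac{\mathrm d}{\mathrm dx}$ and $c_i=D^ic$. For $n\ge1$, $$(c^kD)^nc=\sum_{T\in\mathrm{SYT}(n)}\left(\prod_{i=1}^n\delta_i^{(k)}(T)\,c_i^{w_i(T)}\right)c^{kn+1-\ell(\lambda(T))},$$ where $$\delta_i^{(k)}(T)=\begin{cases}ki-\mathrm{col}_1(T_i)-(k-2), & \text{if } i \text{ is in the first column of } T,\\ \mathrm{col}_m(T_i)-\mathrm{col}_{m+1}(T_i)+1, & \text{if } i \text{ is in the } (m+1)\text{-th column of } T,\ m\ge1.\end{cases}$$
   Context: $(c^kD)^nc$ denotes the result of applying $n$ times to the function $c$ the operator $f\mapsto c^kf'$. A standard Young tableau of size $n$ is a filling of the Ferrers diagram of a partition $\lambda\vdash n$ (French convention: left-justified rows numbered from bottom to top, $\lambda_i$ boxes in row $i$) with $1,\dots,n$, each used exactly once, increasing from left to right in rows and from bottom to top in columns; $\mathrm{SYT}(n)$ is the set of all of them, over all $\lambda\vdash n$. For $T\in\mathrm{SYT}(n)$, $\ell(\lambda(T))$ is the number of rows of $T$, $w_i(T)$ is the number of rows of $T$ with exactly $i$ boxes, $T_i$ is the tableau obtained from $T$ by deleting the entries $i+1,\dots,n$, and $\mathrm{col}_m(T_i)$ is the number of boxes in the $m$-th column of $T_i$. *)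

(* Defs.v *)
From HB Require Import structures.
From mathcomp Require Import all_boot all_order all_algebra.
From mathcomp Require Import all_classical all_reals all_analysis.

Set Implicit Arguments.
Unset Strict Implicit.
Unset Printing Implicit Defensive.

Import Order.TTheory GRing.Theory Num.Theory.
Import numFieldNormedType.Exports.

(* A tableau is the list of its rows, from bottom to top, each row being read
   from left to right; [shape T], the list of the row lengths, is from seq.
   Rows, columns and entries are numbered from 1. *)
Definition tableau := seq (seq nat).

Definition is_partition (lambda : seq nat) : bool :=
  sorted geq lambda && (0 \notin lambda).

(* the m-th column (m >= 1), read from bottom to top *)
Definition column (m : nat) (T : tableau) : seq nat :=
  [seq nth 0 r m.-1 | r <- T & m <= size r].

Definition is_syt (n : nat) (T : tableau) : bool :=
  [&& is_partition (shape T),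
      perm_eq (flatten T) (iota 1 n),
      all (sorted ltn) T &
      (* the columns of index greater than n are empty *)
      all (fun m => sorted ltn (column m T)) (iota 1 n)].

Record SYT (n : nat) : Type := MkSYT { rows :> tableau; _ : is_syt n rows }.

HB.instance Definition _ n := [isSub for @rows n].
HB.instance Definition _ n := [Countable of SYT n by <:].

(* [SYT n] is a finite type: its elements have at most n rows, of length at
   most n, with entries at most n. *)
Definition syt_code n (T : SYT n) : n.-bseq (n.-bseq 'I_n.+1) :=
  insub_bseq n [seq insub_bseq n [seq inord i | i <- r] | r <- rows T].

Definition syt_decode n (B : n.-bseq (n.-bseq 'I_n.+1)) : option (SYT n) :=
  insub [seq [seq val i | i <- bseqval r] | r <- bseqval B].

Lemma syt_codeK n : pcancel (@syt_code n) (@syt_decode n).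
Proof.
case=> T sytT; case/and4P: (sytT) => /andP[_ pos_T] TE _ _.
have szT : sumn (shape T) = n by rewrite -size_flatten (perm_size TE) size_iota.
have le_T : size T <= n.
  rewrite -szT; elim: (T) pos_T => //= r s IHs.
  rewrite inE negb_or eq_sym -lt0n => /andP[r_gt0 /IHs le_s].
  by rewrite -add1n leq_add.
have le_r (r : seq nat) : r \in T -> size r <= n.
  move=> /(map_f size) r_T; rewrite -szT.
  by rewrite -/(shape T) in r_T *; rewrite sumnE (big_rem _ r_T) leq_addr.
have le_i (r : seq nat) i : r \in T -> i \in r -> i < n.+1.
  move=> r_T i_r; have: i \in flatten T by apply/flattenP; exists r.
  by rewrite (perm_mem TE) mem_iota add1n => /andP[].
rewrite /syt_decode /syt_code val_insubd size_map le_T -map_comp.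
rewrite (_ : map _ _ = T); first exact: (valK (MkSYT sytT)).
rewrite -[RHS]map_id; apply/eq_in_map => r r_T /=.
rewrite val_insubd size_map le_r // -map_comp -[RHS]map_id.
by apply/eq_in_map => i i_r /=; rewrite inordK // (le_i r).
Qed.

HB.instance Definition _ n :=
  fintype.isFinite.Build (SYT n) (pcan_enumP (@syt_codeK n)).

(* T_i: the tableau obtained from T by deleting the entries greater than i,
   together with the rows that become empty *)
Definition subtableau (T : tableau) (i : nat) : tableau :=
  [seq r <- [seq [seq j <- s | j <= i] | s <- T] | r != [::]].

Definition col (m : nat) (T : tableau) : nat := size (column m T).

(* the index (from 1) of the column of T containing the entry i *)
Definition column_of (T : tableau) (i : nat) : nat :=
  (index i (nth [::] T (find (fun r => i \in r) T))).+1.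

Definition ell (lambda : seq nat) : nat := size lambda.

Definition w (i : nat) (T : tableau) : nat := count_mem i (shape T).

(* The subtractions are those of the integers. *)
Definition delta (k : nat) (T : tableau) (i : nat) : int :=
  if column_of T i is m.+2 then
    ((col m.+1 (subtableau T i))%:Z - (col m.+2 (subtableau T i))%:Z + 1)%R
  else
    (k%:Z * i%:Z - (col 1 (subtableau T i))%:Z - (k%:Z - 2))%R.

Local Open Scope ring_scope.
Local Open Scope classical_set_scope.

Definition smooth_on (R : realType) (U : set R) (c : R -> R) : Prop :=
  forall (j : nat) (x : R), U x -> derivable (derive1n j c) x 1.

(* the operator c^k D : f |-> c^k f' *)
Definition ckD (R : realType) (k : nat) (c f : R -> R) : R -> R :=
  fun x => c x ^+ k * derive1 f x.

(* Main.v *)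
Require Import Defs.
From HB Require Import structures.
From mathcomp Require Import all_boot all_order all_algebra.
From mathcomp Require Import all_classical all_reals all_analysis.
From mathcomp Require Import zify.

Import Order.TTheory GRing.Theory Num.Theory.
Import numFieldNormedType.Exports.

(** Put [c_0 = c] and attach to a tableau [T] of size [n] the monomial
    [\prod_i c_i ^+ e_i(T)], where [e_i(T)] is the number of rows of length [i]
    for [i >= 1], and [e_0(T) = k * n + 1 - size T].  By the Leibniz rule, [c^k D]
    sends a monomial [\prod_i c_i ^+ e_i] to a sum over [m] of [e_m] times the
    monomial in which one factor [c_m] has become [c_(m+1)] and [k] factors [c]
    have been added ([is_derive_monomial]).  On the monomial of [T] this is the
    effect of adding the entry [n.+1] at the end of a row of length [m], where
    [m = 0] stands for a new row ([exponent_added_box], [monomial_grow]).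

    A standard tableau of size [n.+1] arises in exactly one way from one of size
    [n] and a length [m] at which a box can be added: the new entry is the
    maximum, so it ends its row, and a box can only be added to the lowest row
    of length [m] ([big_SYT_recr]).  A nonzero length [m] is available as soon
    as [e_m <> 0], so the sum over all [m] may be restricted to the available
    ones ([exponent_not_addable]).

    The factor [delta] of an entry [i] depends only on the tableau of the entries
    up to [i]; hence the addition of [n.+1] keeps the earlier factors
    ([delta_added_box]) and contributes a new one, which is exactly [e_m]:
    the difference of the lengths of the columns [m] and [m.+1] counts the rows
    of length [m] ([delta_new_box]).  Induction on [n] from [n = 0], where both
    sides are [c], concludes ([iter_ckD]). *)

(** * Rows and columns *)

Definition nonempty_rows (T : tableau) : tableau := [seq r <- T | r != [::]].

Lemma flatten_nonempty_rows T : flatten (nonempty_rows T) = flatten T.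
Proof. by elim: T => //= -[|i r] T /= ->. Qed.

Lemma nonempty_rows_id T : all (fun r => 0 < size r) T -> nonempty_rows T = T.
Proof.
move=> T_gt0; apply/all_filterP; apply: sub_all T_gt0 => r.
by rewrite -size_eq0 lt0n.
Qed.

Lemma column_cat j A B : column j (A ++ B) = column j A ++ column j B.
Proof. by rewrite /column filter_cat map_cat. Qed.

Lemma column_nonempty_rows j T :
  0 < j -> column j (nonempty_rows T) = column j T.
Proof.
move=> j_gt0; rewrite /column /nonempty_rows -filter_predI.
congr map; apply: eq_filter => r /=; rewrite -size_eq0 -lt0n.
by apply: andb_idr; apply: leq_trans.
Qed.

Lemma mem_column j T i : 0 < j -> i \in column j T -> i \in flatten T.
Proof.
move=> j_gt0 /mapP[r]; rewrite mem_filter => /andP[jr rT] ->.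
by apply/flattenP; exists r => //; apply: mem_nth; case: j jr j_gt0.
Qed.

Lemma size_leq_flatten (T : tableau) r : r \in T -> size r <= size (flatten T).
Proof. by case/splitPr => A B; rewrite flatten_cat !size_cat /=; lia. Qed.

Lemma column_oversize j T : size (flatten T) < j -> column j T = [::].
Proof.
move=> jT; apply: size0nil; rewrite size_map size_filter.
apply/eqP; rewrite eqn0Ngt -has_count; apply/hasPn => r /size_leq_flatten /=; lia.
Qed.

Lemma col_rows_of_length j T :
  0 < j -> Defs.col j T = w j T + Defs.col j.+1 T.
Proof.
move=> j_gt0; rewrite /Defs.col /column !size_map !size_filter /w count_map.
elim: T => //= r T IH; rewrite IH; case: (ltngtP j (size r)) => /=; lia.
Qed.

Lemma col1_size T : all (fun r => 0 < size r) T -> Defs.col 1 T = size T.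
Proof. by move=> T_gt0; rewrite /Defs.col size_map; move/all_filterP: T_gt0 ->. Qed.

(** The orders involved are transitive, so sortedness is pairwise comparison,
    which splits over concatenations; the columns of index greater than [n] are
    empty, hence sorted. *)
Lemma is_sytP n T :
  reflect [/\ pairwise geq (shape T), all (fun r => 0 < size r) T,
              perm_eq (flatten T) (iota 1 n), all (pairwise ltn) T
            & forall j, 0 < j -> pairwise ltn (column j T)]
          (is_syt n T).
Proof.
have geq_tr : transitive geq by move=> a b d /= ab bd; apply: leq_trans bd ab.
have posE : (0 \notin shape T) = all (fun r => 0 < size r) T.
  by elim: T => //= r T IH; rewrite inE negb_or IH eq_sym lt0n.
have rowE : all (sorted ltn) T = all (pairwise ltn) T.
  by apply: eq_all => r; rewrite (sorted_pairwise ltn_trans).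
rewrite /is_syt /is_partition (sorted_pairwise geq_tr) posE rowE.
apply: (iffP and4P).
  case=> /andP[shT pos_T] TE rT cT; split=> // j j_gt0.
  case: (leqP j n) => [j_n|n_j].
    rewrite -(sorted_pairwise ltn_trans); apply: (allP cT).
    by rewrite mem_iota; lia.
  by rewrite column_oversize // (perm_size TE) size_iota.
case=> shT pos_T TE rT cT; split=> //; first exact/andP.
apply/allP => j; rewrite mem_iota => /andP[j_gt0 _].
by rewrite (sorted_pairwise ltn_trans) cT.
Qed.

Lemma is_syt_entry n T i : is_syt n T -> (i \in flatten T) = (0 < i <= n).
Proof. by case/is_sytP => _ _ /perm_mem -> _ _; rewrite mem_iota; lia. Qed.

Lemma is_syt_size n T : is_syt n T -> size T <= n.
Proof.
case/is_sytP => _ pos_T /perm_size; rewrite size_iota => <- _ _.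
by elim: T pos_T => //= r T IH /andP[r_gt0 /IH]; rewrite size_cat; lia.
Qed.

Lemma column_of_catl A B i :
  has (fun s : seq nat => i \in s) A -> column_of (A ++ B) i = column_of A i.
Proof. by move=> iA; rewrite /column_of find_cat iA nth_cat -has_find iA. Qed.

Lemma column_of_catr A B i :
  ~~ has (fun s : seq nat => i \in s) A -> column_of (A ++ B) i = column_of B i.
Proof.
move=> /negbTE iA; rewrite /column_of find_cat iA nth_cat.
by rewrite ltnNge leq_addr /= addKn.
Qed.

Lemma column_of_row (s : seq nat) i :
  i \in s -> column_of [:: s] i = (index i s).+1.
Proof. by rewrite /column_of /= => ->. Qed.

(** * Adding a box to a tableau *)

(** [added_box m x T' T]: the tableau [T] is [T'] with the entry [x] added to the
    lowest row of length [m].  The case [m = 0] of a new top row is not separate: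
    [r] is then an empty row, which [T'] does not show, and the bounds on the
    lengths force [B] to be empty. *)
Variant added_box (m x : nat) : tableau -> tableau -> Prop :=
  AddedBox A r B of size r = m & all (fun s => m < size s) A
                  & all (fun s => 0 < size s <= m) B :
    added_box m x (nonempty_rows (A ++ r :: B)) (A ++ rcons r x :: B).

Lemma nonempty_rows_split m A r B :
  all (fun s => m < size s) A -> all (fun s => 0 < size s <= m) B ->
  nonempty_rows (A ++ r :: B) = A ++ nonempty_rows [:: r] ++ B.
Proof.
move=> A_m B_m; rewrite -cat1s /nonempty_rows !filter_cat -!/(nonempty_rows _).
rewrite (nonempty_rows_id A); last by apply: sub_all A_m => s /=; lia.
by rewrite (nonempty_rows_id B) //; apply: sub_all B_m => s /=; lia.
Qed.

Section AddedBoxTheory.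
Variables (m x : nat) (T' T : tableau).
Hypothesis T'T : added_box m x T' T.

Lemma added_box_perm : perm_eq (flatten T) (x :: flatten T').
Proof.
case: T'T => A r B _ _ _; rewrite flatten_nonempty_rows !flatten_cat /=.
by apply/permP => p; rewrite /= -cats1 !count_cat /=; lia.
Qed.

(** All the numerical data of [T] follow from this: the rows below the new box
    are longer than [m] and those above are not, so the box ends its column. *)
Lemma added_box_column j : 0 < j ->
  column j T = if j == m.+1 then rcons (column j T') x else column j T'.
Proof.
move=> j_gt0; case: T'T => A r B r_m _ B_m.
rewrite column_nonempty_rows // !column_cat.
have colE (s : seq nat) : column j (s :: B) =
    (if j <= size s then [:: nth 0 s j.-1] else [::]) ++ column j B.
  by rewrite /column /=; case: ifP.
rewrite !colE size_rcons r_m nth_rcons r_m.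
case: (ltngtP j m.+1) => [jm | jm | ->].
- have -> : j <= m by [].
  by have -> : j.-1 < m by lia.
- by have -> : (j <= m) = false by lia.
- rewrite /= ltnn eqxx /=.
  suff -> : column m.+1 B = [::] by rewrite !cats0 cats1.
  apply: size0nil; rewrite size_map size_filter.
  apply/eqP; rewrite eqn0Ngt -has_count; apply/hasPn => s /(allP B_m) /=; lia.
Qed.

Lemma added_box_nonempty :
  all (fun s => 0 < size s) T' && all (fun s => 0 < size s) T.
Proof.
case: T'T => A r B r_m A_m B_m.
rewrite !all_cat /= size_rcons andTb.
have -> : all (fun s => 0 < size s) A by apply: sub_all A_m => s /=; lia.
have -> : all (fun s => 0 < size s) B by apply: sub_all B_m => s /=; lia.
rewrite !andbT; apply/allP => s; rewrite mem_filter => /andP[s_n0 _].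
by rewrite lt0n size_eq0.
Qed.

Lemma added_box_col j : 0 < j ->
  Defs.col j T = Defs.col j T' + (j == m.+1).
Proof.
move=> j_gt0; rewrite /Defs.col added_box_column //.
by case: eqP => _; rewrite ?size_rcons ?addn1 ?addn0.
Qed.

(** Taking differences of consecutive column lengths; both sides are kept free
    of subtractions. *)
Lemma added_box_w j : 0 < j ->
  w j T + (j == m) = w j T' + (j == m.+1).
Proof.
move=> j_gt0; have := added_box_col j j_gt0; have := added_box_col j.+1 isT.
by rewrite (col_rows_of_length j T) // (col_rows_of_length j T') // eqSS; lia.
Qed.

Lemma added_box_size : size T = size T' + (m == 0).
Proof.
have /andP[pos_T' pos_T] := added_box_nonempty.
by rewrite -!col1_size // added_box_col // eqSS eq_sym.
Qed.

Lemma added_box_subtableau i : i < x -> subtableau T i = subtableau T' i.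
Proof.
have subE S : subtableau (nonempty_rows S) i = subtableau S i.
  rewrite /subtableau /nonempty_rows.
  by elim: S => //= -[|a s] S /= ->.
case: T'T => A r B _ _ _ ix; rewrite subE /subtableau !map_cat /=.
by rewrite filter_rcons leqNgt ix.
Qed.

Lemma added_box_column_of i : i != x -> column_of T i = column_of T' i.
Proof.
case: T'T => A r B r_m A_m B_m ix; rewrite (nonempty_rows_split m) //.
case iA: (has (fun s => i \in s) A); first by rewrite !column_of_catl.
rewrite !(column_of_catr A) ?iA // -cat1s.
case ir: (i \in r).
  have -> : nonempty_rows [:: r] = [:: r] by case: (r) ir.
  have irx : i \in rcons r x by rewrite mem_rcons inE ir orbT.
  rewrite !(column_of_catl [:: _]) /= ?ir ?irx // !column_of_row //.
  by rewrite -cats1 index_cat ir.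
rewrite !column_of_catr //=.
  by case: (r != [::]) => //=; rewrite ir.
by rewrite mem_rcons inE (negbTE ix) ir.
Qed.

Lemma added_box_column_of_new : x \notin flatten T' -> column_of T x = m.+1.
Proof.
case: T'T => A r B r_m A_m B_m; rewrite flatten_nonempty_rows flatten_cat /=.
rewrite !mem_cat !negb_or => /and3P[xA xr _].
have xrx : x \in rcons r x by rewrite mem_rcons mem_head.
rewrite (column_of_catr A); last first.
  apply/hasPn => s sA; apply: contra xA => xs.
  by apply/flattenP; exists s.
rewrite -cat1s (column_of_catl [:: _]) /= ?xrx // column_of_row //.
by rewrite -cats1 index_cat (negbTE xr) /= eqxx addn0 r_m.
Qed.

End AddedBoxTheory.

Lemma iota1S n : iota 1 n.+1 = rcons (iota 1 n) n.+1.
Proof. by rewrite -(addn1 n) iotaD addn1 cats1. Qed.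

(** The new entry exceeds all others and ends both its row and its column, and
    the rows below it were longer than the row that it extends. *)
Lemma syt_add_box n m T' T :
  added_box m n.+1 T' T -> is_syt n T' -> is_syt n.+1 T.
Proof.
move=> T'T sytT'; have le_n i := is_syt_entry n T' i sytT'.
have /andP[_ pos_T] := added_box_nonempty _ _ _ _ T'T.
have permT := added_box_perm _ _ _ _ T'T.
have colT := added_box_column _ _ _ _ T'T.
case/is_sytP: sytT' => shT' _ permT' rowT' colT'; apply/is_sytP; split=> //.
- case: T'T shT' => A r B r_m A_m B_m; rewrite (nonempty_rows_split m) //.
  rewrite /shape !pairwise_map !pairwise_cat /=.
  case/and5P=> _ -> _ _ ->; rewrite andbT /=; apply/andP; split.
    apply/allrelP => a b aA; rewrite inE => /orP[/eqP->|bB] /=.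
      by rewrite size_rcons r_m; apply: (allP A_m).
    by have := allP A_m _ aA; have := allP B_m _ bB => /=; lia.
  by apply/allP => b /(allP B_m) /=; rewrite size_rcons r_m; lia.
- apply: perm_trans permT _.
  by rewrite iota1S perm_sym perm_rcons perm_cons perm_sym.
- case: T'T rowT' le_n => A r B r_m A_m B_m.
  rewrite flatten_nonempty_rows flatten_cat (nonempty_rows_split m) //.
  rewrite !all_cat /= pairwise_rcons => /and3P[-> rowr ->] le_n.
  rewrite andTb andbT; apply/andP; split; last by case: (r) rowr => // a s /andP[].
  apply/allP => i ir.
  by rewrite /= ltnS; move: (le_n i); rewrite !mem_cat ir orbT => /esym /andP[].
- move=> j j_gt0; rewrite colT //; case: eqP => _; rewrite ?colT' //.
  rewrite pairwise_rcons colT' // andbT; apply/allP => i iT'.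
  by have := mem_column _ _ _ j_gt0 iT'; rewrite le_n /=; lia.
Qed.

(** The maximal entry ends its row [rcons r n.+1].  A higher row cannot have the
    same length, since its last entry would have to be larger; so the rows above
    are no longer than [r], and removing the entry leaves a tableau. *)
Lemma syt_remove_box n T : is_syt n.+1 T ->
  exists m T', added_box m n.+1 T' T /\ is_syt n T'.
Proof.
move=> sytT; have le_n i := is_syt_entry n.+1 T i sytT.
have /flattenP[s sT ns] : n.+1 \in flatten T by rewrite le_n /=.
case/is_sytP: sytT => shT pos_T permT rowT colT.
have : pairwise ltn s by apply: (allP rowT).
have s_n i : i \in s -> i <= n.+1.
  move=> i_s; have : i \in flatten T by apply/flattenP; exists s.
  by rewrite le_n => /andP[].
(* the entry n.+1 is maximal, hence the last one of its row *)
case/splitPr: ns sT s_n => r [|i q] sT s_n; last first.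
  rewrite pairwise_cat /= => /and4P[_ _ /andP[+ _] _].
  have := s_n i; rewrite mem_cat !inE eqxx !orbT => /(_ isT) i_n.
  by rewrite ltnNge i_n.
move=> {s_n} _; rewrite cats1 in sT.
case/splitPr: sT le_n shT pos_T permT rowT colT => A B le_n shT pos_T permT rowT colT.
have A_m : all (fun s => size r < size s) A.
  move: shT; rewrite /shape pairwise_map pairwise_cat allrel_consr /=.
  by rewrite size_rcons => /and3P[/andP[A_r _] _ _].
have B_m : all (fun s => 0 < size s <= size r) B.
  apply/allP => q qB; have q_gt0 : 0 < size q.
    by apply: (allP pos_T); rewrite mem_cat inE qB !orbT.
  rewrite q_gt0 /= leqNgt; apply/negP => r_q.
  have q_r : size q = (size r).+1.
    apply/eqP; rewrite eqn_leq r_q andbT.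
    move: shT; rewrite /shape pairwise_map pairwise_cat /=.
    by case/and4P => _ _ /allP/(_ _ qB) /=; rewrite size_rcons.
  (* q and rcons r n.+1 have the same length, so the last entry of q lies above
     n.+1 in its column, hence is larger: impossible *)
  have := colT (size r).+1 isT; rewrite column_cat pairwise_cat.
  have -> : column (size r).+1 (rcons r n.+1 :: B) =
            n.+1 :: column (size r).+1 B.
    by rewrite /column /= size_rcons leqnn /= nth_rcons ltnn eqxx.
  rewrite [pairwise _ (_ :: _)]/=; case/and4P => _ _ /allP /(_ (nth 0 q (size r))) + _.
  have -> : nth 0 q (size r) \in column (size r).+1 B.
    by apply: (map_f (fun s => nth 0 s (size r))); rewrite mem_filter r_q.
  move=> /(_ isT) /=; apply/negP; rewrite -leqNgt.
  have : nth 0 q (size r) \in flatten (A ++ rcons r n.+1 :: B).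
    apply/flattenP; exists q; first by rewrite mem_cat inE qB !orbT.
    by rewrite mem_nth.
  by rewrite le_n => /andP[].
have T'T := AddedBox (size r) n.+1 A r B erefl A_m B_m.
exists (size r), (nonempty_rows (A ++ r :: B)); split=> //.
have permT' : perm_eq (flatten (nonempty_rows (A ++ r :: B))) (iota 1 n).
  rewrite -(perm_cons n.+1) -(permPl (added_box_perm _ _ _ _ T'T)).
  by rewrite (permPl permT) iota1S perm_rcons.
apply/is_sytP; split=> //.
- move: shT; rewrite /shape !pairwise_map => shT.
  apply: (pairwise_filter (fun s : seq nat => s != [::])).
  move: shT; rewrite !pairwise_cat !allrel_consr /=.
  case/and4P => /andP[_ ->] -> _ ->; rewrite !andbT.
  apply/andP; split; first by apply: sub_all A_m => q /= /ltnW.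
  by apply: sub_all B_m => q /= /andP[].
- by have /andP[] := added_box_nonempty _ _ _ _ T'T.
- rewrite all_filter; move: rowT; rewrite !all_cat /= pairwise_rcons.
  case/and3P => rA /andP[_ rr] rB.
  rewrite rr implybT /=; apply/andP; split.
    by apply: sub_all rA => q /= ->; rewrite implybT.
  by apply: sub_all rB => q /= ->; rewrite implybT.
- move=> j j_gt0; have := colT j j_gt0.
  rewrite (added_box_column _ _ _ _ T'T) //; case: eqP => // _.
  by rewrite pairwise_rcons => /andP[].
Qed.

(** * Where a box can be added *)

Definition addable (m : nat) (T : tableau) : bool := (m == 0) || (m \in shape T).

(** Meaningful only when [addable m T]; a box in a new row is covered as well,
    since [find] then returns the number of rows and [nth] an empty row. *)
Definition add_box (x m : nat) (T : tableau) : tableau :=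
  let p := find (fun r => size r <= m) T in
  take p T ++ rcons (nth [::] T p) x :: drop p.+1 T.

Lemma added_box_addable m x T' T : added_box m x T' T -> addable m T'.
Proof.
case=> A r B <- A_m B_m; rewrite /addable (nonempty_rows_split (size r)) //.
case: r A_m B_m => //= a r _ _.
by rewrite /shape !map_cat /= mem_cat inE eqxx orbT.
Qed.

Lemma added_boxE m x T' T : added_box m x T' T -> T = add_box x m T'.
Proof.
case=> A r B r_m A_m B_m; rewrite (nonempty_rows_split m) // /add_box.
have A_F : has (fun s => size s <= m) A = false.
  by apply/negbTE/hasPn => s /(allP A_m) /=; rewrite ltnNge.
rewrite find_cat A_F; case: r r_m => [|a r] /= r_m.
  have -> : B = [::] by case: B B_m => //= s B; rewrite -r_m; lia.
  by rewrite cats0 addn0 take_size nth_default // drop_oversize.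
rewrite r_m leqnn addn0 take_size_cat // nth_cat ltnn subnn /=.
by rewrite -addn1 addnC -drop_drop drop_size_cat //= drop0.
Qed.

(** The first row [r] of length at most [m] has length exactly [m], since a later
    row of length [m] is not longer than [r]. *)
Lemma add_boxP n x m T :
  is_syt n T -> addable m T -> added_box m x T (add_box x m T).
Proof.
case/is_sytP => shT pos_T _ _ _ mT.
suff [A [r [B [r_m A_m B_m TE]]]] : exists A r B,
    [/\ size r = m, all (fun s => m < size s) A,
        all (fun s => 0 < size s <= m) B & T = nonempty_rows (A ++ r :: B)].
  have T'T := AddedBox m x A r B r_m A_m B_m.
  by rewrite TE -(added_boxE _ _ _ _ T'T).
have all_gt A : ~~ has (fun s : seq nat => size s <= m) A ->
    all (fun s => m < size s) A.
  by move=> A_m; rewrite -all_predC in A_m; apply: sub_all A_m => s /=; rewrite ltnNge.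
have [hasT|hasN] := boolP (has (fun s => size s <= m) T); last first.
  have m0 : m = 0.
    case/orP: mT => [/eqP //|/mapP[s sT m_s]].
    by case/negP: hasN; apply/hasP; exists s; rewrite // m_s.
  subst m; exists T, [::], [::]; split=> //.
  by rewrite (nonempty_rows_split 0) //= cats0.
case: (split_find hasT) shT pos_T mT => r A B r_le A_gt shT pos_T mT.
rewrite cat_rcons in shT pos_T mT *.
have r_gt0 : 0 < size r by apply: (allP pos_T); rewrite mem_cat inE eqxx orbT.
have B_le : all (fun s => 0 < size s <= size r) B.
  move: shT pos_T; rewrite /shape pairwise_map pairwise_cat all_cat /=.
  case/and4P => _ _ r_B _ /and3P[_ _ B_gt0].
  apply/allP => s sB; rewrite (allP B_gt0) //.
  exact: (allP r_B).
have r_m : size r = m.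
  apply/eqP; rewrite eqn_leq r_le /=.
  case/orP: mT => [/eqP -> //|/mapP[s + m_s]].
  rewrite mem_cat inE => /or3P[sA|/eqP <-|/(allP B_le)].
  - by have := allP (all_gt _ A_gt) _ sA; rewrite /= -m_s ltnn.
  - by rewrite m_s.
  - by rewrite m_s => /andP[].
rewrite r_m in B_le; exists A, r, B; split=> //; first exact: all_gt.
by rewrite nonempty_rows_id.
Qed.

Lemma addable_leq n m T : is_syt n T -> addable m T -> m <= n.
Proof.
move=> sytT; case/orP => [/eqP -> //|/mapP[r rT ->]].
have := size_leq_flatten _ _ rT.
by case/is_sytP: sytT => _ _ /perm_size -> _ _; rewrite size_iota.
Qed.

Lemma subtableau_id n T : is_syt n T -> subtableau T n = T.
Proof.
move=> sytT; have le_n i := is_syt_entry n T i sytT.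
case/is_sytP: sytT => _ pos_T _ _ _; rewrite /subtableau.
rewrite -[RHS](nonempty_rows_id _ pos_T) /nonempty_rows.
congr [seq r <- _ | r != [::]]; rewrite -[RHS]map_id.
apply/eq_in_map => s sT; apply/all_filterP/allP => i i_s.
suff : i \in flatten T by rewrite le_n => /andP[].
by apply/flattenP; exists s.
Qed.

(** * Exponents and coefficients *)

Lemma delta_added_box k m x i T' T :
  added_box m x T' T -> i < x -> delta k T i = delta k T' i.
Proof.
move=> T'T ix; rewrite /delta (added_box_column_of _ _ _ _ T'T) ?(ltn_eqF ix) //.
by rewrite (added_box_subtableau _ _ _ _ T'T).
Qed.

(** The exponent of [c_i = D^i c] in the term of a tableau of size [n]. *)
Definition exponent (k n : nat) (T : tableau) (i : nat) : nat :=
  if i is 0 then k * n + 1 - size T else w i T.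

(** The row that receives the box stops having length [m] and gets length
    [m.+1], and [c^k] multiplies everything; at [i = 0] the term [(i == m)]
    records that a new row lowers the exponent of [c]. *)
Lemma exponent_added_box k n m T' T i :
  0 < k -> is_syt n T' -> added_box m n.+1 T' T ->
  exponent k n.+1 T i + (i == m) =
    exponent k n T' i + (i == m.+1) + (if i is 0 then k else 0).
Proof.
move=> k_gt0 sytT' T'T; have T'n := is_syt_size _ _ sytT'.
case: i => [|i] /=; last by rewrite addn0; apply: (added_box_w _ _ _ _ T'T).
rewrite (added_box_size _ _ _ _ T'T) addn0 (eq_sym 0).
have : n <= k * n by rewrite leq_pmull.
by rewrite mulnS; case: (m == 0) => /=; lia.
Qed.

(** For a new row, [delta] is [k (n+1) - (size T' + 1) - (k - 2)], that is
    [k n + 1 - size T'].  For a row of length [m >= 1], it is the difference of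
    the lengths of the columns [m] and [m.+1] of [T'], the [+ 1] making up for
    the box that the latter has just received. *)
Lemma delta_new_box k n m T' T :
  0 < k -> is_syt n T' -> added_box m n.+1 T' T ->
  delta k T n.+1 = Posz (exponent k n T' m).
Proof.
move=> k_gt0 sytT' T'T; have T'n := is_syt_size _ _ sytT'.
have sytT := syt_add_box _ _ _ _ T'T sytT'.
rewrite /delta (subtableau_id _ _ sytT).
rewrite (added_box_column_of_new _ _ _ _ T'T); last first.
  by rewrite (is_syt_entry n) // ltnn andbF.
have n_kn : n <= k * n by rewrite leq_pmull.
case: m T'T => [|m] T'T /=.
  have /andP[pos_T' _] := added_box_nonempty _ _ _ _ T'T.
  by rewrite (added_box_col _ _ _ _ T'T) // col1_size // /=; nia.
rewrite !(added_box_col _ _ _ _ T'T) // eqxx (col_rows_of_length _ T') //.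
by rewrite (ltn_eqF (ltnSn m.+1)); lia.
Qed.

Lemma exponent_not_addable k n m T : ~~ addable m T -> exponent k n T m = 0.
Proof. by case: m => // m; rewrite /addable /= => /count_memPn. Qed.

Lemma exponent_large k n m T : is_syt n T -> n < m -> exponent k n T m = 0.
Proof.
move=> sytT nm; apply: exponent_not_addable; apply/negP => /(addable_leq _ _ _ sytT).
by rewrite leqNgt nm.
Qed.

Lemma syt_rows n (T : SYT n) : is_syt n (rows T). Proof. exact: (valP T). Qed.

(** * Standard tableaux of size [n.+1] from those of size [n] *)

Section Growth.
Variable n : nat.

Lemma growP (T' : SYT n) (m : nat) :
  added_box (if addable m T' then m else 0) n.+1 T'
    (add_box n.+1 (if addable m T' then m else 0) T').
Proof. by apply: (add_boxP n); [exact: (syt_rows _ T') | case: ifP]. Qed.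

(** A length [m] that is not available is replaced by [0], which always is, so
    that [grow] is total; [big_SYT_recr] discards these values. *)
Definition grow (T' : SYT n) (m : nat) : SYT n.+1 :=
  MkSYT (syt_add_box _ _ _ _ (growP T' m) (syt_rows _ T')).

Lemma subtableau_is_syt (T : SYT n.+1) : is_syt n (subtableau T n).
Proof.
have [m [T' [T'T sytT']]] := syt_remove_box _ _ (syt_rows _ T).
by rewrite (added_box_subtableau _ _ _ _ T'T) // (subtableau_id n).
Qed.

Definition shrink (T : SYT n.+1) : SYT n := MkSYT (subtableau_is_syt T).

Lemma growK T' m : shrink (grow T' m) = T'.
Proof.
apply: val_inj; rewrite /= (added_box_subtableau _ _ _ _ (growP T' m)) //.
exact: subtableau_id (syt_rows _ T').
Qed.

Lemma column_of_grow (T' : SYT n) m :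
  column_of (grow T' m) n.+1 = (if addable m T' then m else 0).+1.
Proof.
apply: (added_box_column_of_new _ _ _ _ (growP T' m)).
by rewrite (is_syt_entry n) ?(syt_rows _ T') // ltnn andbF.
Qed.

Lemma shrinkK (T : SYT n.+1) : grow (shrink T) (column_of T n.+1).-1 = T.
Proof.
have [m [T' [T'T sytT']]] := syt_remove_box _ _ (syt_rows _ T).
have subT : subtableau T n = T'.
  by rewrite (added_box_subtableau _ _ _ _ T'T) // (subtableau_id n).
have colT : column_of T n.+1 = m.+1.
  apply: (added_box_column_of_new _ _ _ _ T'T).
  by rewrite (is_syt_entry n) // ltnn andbF.
apply: val_inj; rewrite colT /= subT.
by rewrite (added_box_addable _ _ _ _ T'T) -(added_boxE _ _ _ _ T'T).
Qed.

Lemma column_of_shrink (T : SYT n.+1) : (column_of T n.+1).-1 <= n.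
Proof.
rewrite -(shrinkK T) column_of_grow /=.
by case: ifP => // /(addable_leq _ _ _ (syt_rows _ (shrink T))).
Qed.

(** The tableaux over [T'] are indexed by the column of [n.+1], whose inverse is
    [grow T'] on the available lengths. *)
Lemma big_SYT_recr (R : Type) (idx : R) (op : Monoid.com_law idx)
    (F : SYT n.+1 -> R) :
  \big[op/idx]_(T : SYT n.+1) F T =
  \big[op/idx]_(T' : SYT n)
    \big[op/idx]_(m < n.+1 | addable m T') F (grow T' m).
Proof.
rewrite (partition_big shrink predT) //=; apply: eq_bigr => T' _.
rewrite (reindex_onto (fun m : 'I_n.+1 => grow T' m)
           (fun T : SYT n.+1 => inord (column_of T n.+1).-1)).
  apply: eq_bigl => m; rewrite growK eqxx column_of_grow -val_eqE /= inordK.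
    case: ifP => [_|/negbT]; first by rewrite eqxx.
    by rewrite /addable negb_or eq_sym => /andP[/negbTE].
  by case: ifP => // _; apply: ltn_ord.
move=> T /eqP <-; rewrite inordK ?shrinkK // ltnS; exact: column_of_shrink.
Qed.
End Growth.

(** * The operator on monomials *)

Local Open Scope ring_scope.
Local Open Scope classical_set_scope.

Lemma is_derive_big_sum (R : realType) (I : Type) (s : seq I)
    (f : I -> R -> R) (x : R) (df : I -> R) :
  (forall i, is_derive x 1 (f i) (df i)) ->
  is_derive x 1 (fun y => \sum_(i <- s) f i y) (\sum_(i <- s) df i).
Proof.
move=> fdf; elim: s => [|i s IH].
  have -> : (fun y => \sum_(i <- [::]) f i y) = cst 0.
    by apply/funext => y; rewrite big_nil.
  by rewrite big_nil; apply: is_derive_cst.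
have -> : (fun y => \sum_(j <- i :: s) f j y) = f i + fun y => \sum_(j <- s) f j y.
  by apply/funext => y; rewrite big_cons.
by rewrite big_cons; apply: is_deriveD.
Qed.

(** The Leibniz rule for a monomial in a sequence of functions of which each is
    the derivative of the previous one.  The truncated [e i - (i == m)] is
    harmless: when it truncates, the coefficient [e m] is [0]. *)
Lemma is_derive_monomial (R : realType) (c : nat -> R -> R) (x : R)
    (e : nat -> nat) (N : nat) :
  (forall i, is_derive x 1 (c i) (c i.+1 x)) ->
  is_derive x 1 (fun y => \prod_(i < N) c i y ^+ e i)
    (\sum_(m < N)
       (e m)%:R * ((\prod_(i < N) c i x ^+ (e i - (i == m :> nat))) * c m.+1 x)).
Proof.
move=> dc; elim: N => [|N IH].
  have -> : (fun y => \prod_(i < 0) c i y ^+ e i) = cst 1.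
    by apply/funext => y; rewrite big_ord0.
  by rewrite big_ord0; apply: is_derive_cst.
have -> : (fun y => \prod_(i < N.+1) c i y ^+ e i) =
          (fun y => \prod_(i < N) c i y ^+ e i) * c N ^+ e N.
  apply/funext => y; rewrite big_ord_recr /=.
  by rewrite [RHS]/GRing.mul /= exprfctE.
apply: is_derive_eq.
rewrite big_ord_recr /= addrC exprfctE; congr (_ + _).
  rewrite /GRing.scale /= mulrCA -mulrA; congr (_ * _).
  rewrite big_ord_recr /= eqxx subn1 mulrCA -!mulrA; congr (_ * _).
  by apply: eq_bigr => i _; rewrite (ltn_eqF (ltn_ord i)) subn0.
rewrite /GRing.scale /= mulr_sumr; apply: eq_bigr => m _.
rewrite big_ord_recr /= (gtn_eqF (ltn_ord m)) subn0.
by rewrite mulrCA; congr (_ * _); rewrite mulrCA -mulrA.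
Qed.

Lemma prod_expr_eq (R : comPzRingType) (a : nat -> R) (N m : nat) :
  (m < N)%N -> \prod_(i < N) a i ^+ (i == m :> nat) = a m.
Proof.
move=> mN; rewrite (bigD1 (Ordinal mN)) //= eqxx expr1 big1 ?mulr1 // => i.
by rewrite -val_eqE /= => /negbTE ->.
Qed.

(** The variable with index [n.+1] occurs on the left only if [m = n]: no row of
    a tableau of size [n] is longer than [n]. *)
Lemma monomial_grow (R : comPzRingType) (a : nat -> R) k n (T' : SYT n) m :
  (0 < k)%N -> (m <= n)%N -> addable m T' -> (0 < exponent k n T' m)%N ->
  a 0%N ^+ k * ((\prod_(i < n.+1) a i ^+ (exponent k n T' i - (i == m :> nat)))
                * a m.+1)
  = \prod_(i < n.+2) a i ^+ exponent k n.+1 (grow n T' m) i.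
Proof.
move=> k_gt0 mn mT' e_gt0.
have eE i : exponent k n.+1 (grow n T' m) i =
   (exponent k n T' i - (i == m) + (i == m.+1) + (if i is 0 then k else 0))%N.
  have grT := growP n T' m; rewrite mT' in grT.
  have := exponent_added_box k n m T' _ i k_gt0 (syt_rows _ T') grT.
  rewrite /= mT'; have : ((i == m) <= exponent k n T' i)%N.
    by case: eqP => // ->.
  by lia.
under [RHS]eq_bigr => i _ do rewrite eE !exprD.
rewrite !big_split /= prod_expr_eq // mulrC; congr (_ * _ * _).
  rewrite [RHS]big_ord_recr /=.
  have /= -> := exponent_large k n n.+1 T' (syt_rows _ T') (ltnSn n).
  by rewrite sub0n expr0 mulr1.
by rewrite big_ord_recl big1 ?mulr1 // => i _; rewrite expr0.
Qed.

(** The expansion with all the powers gathered in one monomial, starting at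
    [n = 0] with the empty tableau.  The induction hypothesis holds on the open
    set [U], hence near [x], and can be differentiated at [x]. *)
Lemma iter_ckD (R : realType) (k : nat) (hk : (0 < k)%N)
    (U : set R) (hU : open U) (c : R -> R) (hc : smooth_on U c) (n : nat) x :
  U x ->
  iter n (ckD k c) c x =
  \sum_(T : SYT n) (\prod_(1 <= i < n.+1) (delta k T i)%:~R)
    * \prod_(i < n.+1) derive1n i c x ^+ exponent k n T i.
Proof.
elim: n x => [|n IH] x Ux.
  have syt0 : is_syt 0 [::] by [].
  rewrite (big_pred1 (MkSYT syt0)) => [|T]; last first.
    apply/esym/eqP/val_inj/size0nil/eqP; rewrite -leqn0.
    exact: is_syt_size (syt_rows _ T).
  by rewrite big_geq // big_ord1 /= muln0 expr1 mul1r.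
rewrite iterS /ckD.
have dc i : is_derive x 1 (derive1n i c) (derive1n i.+1 c x).
  by rewrite derive1nS derive1E; apply/derivableP/hc.
pose F (T : SYT n) (y : R) := (\prod_(1 <= i < n.+1) (delta k T i)%:~R)
    * \prod_(i < n.+1) derive1n i c y ^+ exponent k n T i.
have dF (T : SYT n) : is_derive x 1 (F T)
  ((\prod_(1 <= i < n.+1) (delta k T i)%:~R) *
   \sum_(m < n.+1) (exponent k n T m)%:R *
     ((\prod_(i < n.+1) derive1n i c x ^+ (exponent k n T i - (i == m :> nat)))
      * derive1n m.+1 c x)).
  exact: (is_deriveZ _ (is_derive_monomial _ _ _ _ _ dc)).
have -> : (iter n (ckD k c) c)^`() x = (fun y => \sum_T F T y)^`() x.
  rewrite !derive1E; apply: near_eq_derive.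
  by near=> y; apply: IH; near: y; apply: open_nbhs_nbhs.
rewrite derive1E (@derive_val _ _ _ _ _ _ _ (is_derive_big_sum _ _ _ _ _ _ dF)).
rewrite big_SYT_recr mulr_sumr; apply: eq_bigr => T _.
rewrite [RHS]big_mkcond mulrCA !mulr_sumr; apply: eq_bigr => m _.
have [mT|mT] := boolP (addable m T); last first.
  by rewrite exponent_not_addable // mul0r !mulr0.
have grT := growP n T m; rewrite mT in grT.
rewrite [X in _ = X * _]big_nat_recr //; set G := grow n T m.
have -> : \prod_(1 <= i < n.+1) (delta k G i)%:~R =
          \prod_(1 <= i < n.+1) (delta k T i)%:~R :> R.
  apply: eq_big_nat => i /andP[_ i_n]; congr (_%:~R).
  by rewrite /= mT (delta_added_box _ _ _ _ _ _ grT).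
have -> : delta k G n.+1 = Posz (exponent k n T m).
  by rewrite /= mT (delta_new_box _ _ _ _ _ hk (syt_rows _ T) grT).
rewrite [X in X * _]/=.
rewrite -!mulrA; congr (_ * _); rewrite mulrCA.
have [->|e_gt0] := posnP (exponent k n T m); first by rewrite !mul0r.
congr (_ * _); apply: (monomial_grow _ (fun i => derive1n i c x)) => //.
by rewrite -ltnS ltn_ord.
Unshelve. all: by end_near.
Qed.

(* The exponent k * n + 1 - ell is a subtraction of natural numbers, which does
   not truncate since ell <= n <= k * n. *)
Theorem mainTheorem19 (R : realType) (k : nat) (hk : (0 < k)%N)
    (U : set R) (hU : open U) (c : R -> R) (hc : smooth_on U c)
    (n : nat) (hn : (0 < n)%N) (x : R) (hx : U x) :
  iter n (ckD k c) c x =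
  \sum_(T : SYT n)
    (\prod_(1 <= i < n.+1) ((delta k T i)%:~R * derive1n i c x ^+ w i T))
    * c x ^+ (k * n + 1 - ell (shape (rows T)))%N.
Proof.
rewrite (iter_ckD R k hk U hU c hc n x hx); apply: eq_bigr => T _.
rewrite big_split /= -mulrA; congr (_ * _).
rewrite big_ord_recl /= mulrC /ell size_map; congr (_ * _).
by rewrite big_add1 big_mkord.
Qed.
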